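(* For $(\alpha,\beta)\in\{(1,1),(2,2),(1,2)\}$ let $f_{\alpha\beta}\in C^2(\mathbb{R})\cap L^1(\mathbb{R})$ be mirror symmetric and strongly tempered, in the sense that there exist $r_0,C,\eta>0$ such that $|f_{\alpha\beta}(x)|<C|x|^{-1-\eta}$ for all $|x|>r_0$. Let $\mathcal{F}=(f_{11},f_{22},f_{12})$. If the equidistant configuration is a minimizer of $E_{\mathcal{F}}$ at high density, i.e. if there exists $\rho_0$ such that for all $N\in2\mathbb{N}$ and all $\rho>\rho_0$, $e^{\rho}$ is a minimizer of $E_{\mathcal{F}}$ in $\mathcal{A}_N^{\rho}$, then $$\widehat{f_{12}}(k)+\frac12\Big(\widehat{f_{11}}(k)+\widehat{f_{22}}(k)\Big)\ge 0\qquad\text{for all }k\in\mathbb{R}.$$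
   Context: The Fourier transform of a mirror symmetric $f\in L^1(\mathbb{R})$ is $\widehat{f}(k)=\frac{1}{\sqrt{2\pi}}\int_{\mathbb{R}}f(x)\cos(kx)\,dx$. For $\rho>0$ and a positive even integer $N$ (written $N\in 2\mathbb{N}$), let $$\mathcal{A}_N^{\rho}=\{(x_k)_{k\in\mathbb{Z}}\subset\mathbb{R}:\ x_0=0,\ x_k<x_{k+1}\text{ and }x_{k+N}=x_k+\rho^{-1}N\ \text{ for all }k\in\mathbb{Z}\}$$ be the class of $N$-periodic configurations of density $\rho$. The particle $x_k$ is of type $\epsilon_k$, where $\epsilon_k=1$ if $k$ is odd and $\epsilon_k=2$ if $k$ is even. The equidistant configuration is $e^{\rho}:=(k\rho^{-1})_{k\in\mathbb{Z}}\in\mathcal{A}_N^{\rho}$. Given mirror symmetric interaction potentials $f_{11},f_{22},f_{12}$ (i.e. $f_{\alpha\beta}(-x)=f_{\alpha\beta}(x)$), with $f_{21}:=f_{12}$, and $\mathcal{F}=(f_{11},f_{22},f_{12})$, the energy of $X=(x_i)_{i\in\mathbb{Z}}\in\mathcal{A}_N^{\rho}$ is $$E_{\mathcal{F}}(X)=\frac1N\sum_{n=1}^{N}\ \sum_{k\in\mathbb{Z},\,k\neq n} f_{\epsilon_n\epsilon_k}(x_k-x_n).$$ *)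

(* Defs.v *)
From HB Require Import structures.
From mathcomp Require Import all_boot all_order all_algebra.
From mathcomp Require Import all_classical all_reals all_analysis.
Set Implicit Arguments.
Unset Strict Implicit.
Unset Printing Implicit Defensive.
Import Order.TTheory GRing.Theory Num.Theory.
Import numFieldNormedType.Exports.
Local Open Scope classical_set_scope.
Local Open Scope ring_scope.

Section potentials.
Context {R : realType}.
Implicit Types (f : R -> R).

Definition mirror_symmetric f := forall x, f (- x) = f x.

Definition class_C2 f :=
  [/\ forall x, derivable f x 1, forall x, derivable (derive1 f) x 1
    & continuous (derive1n 2 f)].

Definition class_L1 f :=
  (@lebesgue_measure R).-integrable [set: R] (EFin \o f).

Definition strongly_tempered f :=
  exists r0 C eta : R, [/\ 0 < r0, 0 < C, 0 < eta
    & forall x, r0 < `|x| -> `|f x| < C * `|x| `^ (- 1 - eta)].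

(* The Fourier transform of a mirror symmetric function: the sine part vanishes,
   so only the real cosine integral is kept. *)
Definition fourier f (k : R) : R :=
  (Num.sqrt (2 * pi))^-1 * \int[@lebesgue_measure R]_x (f x * cos (k * x)).

End potentials.

Inductive species := type1 | type2.

Definition species_of (k : int) : species :=
  if (2 %| k)%Z then type2 else type1.

Section energy.
Context {R : realType}.

Definition interaction (f11 f22 f12 : R -> R) (a b : species) : R -> R :=
  match a, b with
  | type1, type1 => f11
  | type2, type2 => f22
  | _, _ => f12
  end.

(* Unconditional sum of a family of reals over D: sum of the positive parts
   minus sum of the negative parts (meaningful when the family is [summable]). *)
Definition sum_over (I : choiceType) (D : set I) (u : I -> R) : R :=
  fine (esum D (EFin \o u)^\+ - esum D (EFin \o u)^\-)%E.

Definition periodic_config (rho : R) (N : nat) : set (int -> R) :=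
  [set x | [/\ x 0 = 0, forall k, x k < x (k + 1)
             & forall k, x (k + N%:Z) = x k + rho^-1 * N%:R]].

Definition equidistant (rho : R) : int -> R := fun k => k%:~R * rho^-1.

Definition energy (f11 f22 f12 : R -> R) (N : nat) (x : int -> R) : R :=
  N%:R^-1 * \sum_(1 <= n < N.+1)
    sum_over [set k : int | k != n%:Z]
      (fun k => interaction f11 f22 f12 (species_of n%:Z) (species_of k)
                  (x k - x n%:Z)).

Definition is_minimizer (T : Type) (E : T -> R) (A : set T) (x : T) :=
  A x /\ forall y, A y -> E x <= E y.

End energy.

(* Main.v *)
(** Fix [ka > 0], put [L = 2 pi / ka], and perturb the equidistant configuration
    on a macroscopic scale: for [s] in [[0, 1/2]] let the [N] particles of a
    period [L] be the points where [x + s / ka * sin (ka x)] is a multiple of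
    [L / N], so that their density is proportional to [1 + s cos (ka x)].  Within
    a parity class the sum over the neighbours of a particle is a Riemann sum:
    as [N] grows, [2 L / N] times the interaction of a particle at [c] with
    the particles of both types tends, uniformly in [c], to the integral of
    [(f_a1 + f_a2)(z) (1 + s cos (ka (z + c)))], which by mirror symmetry is a
    constant plus [s cos (ka c)] times the cosine integral of [f_a1 + f_a2] at
    [ka].  The average of [cos (ka c)] over a parity class tends to [s / 2], and
    the self-interaction is the same for every [s], so comparing [s = 1/2] with
    [s = 0] gives [0 <= f_11 + 2 f_12 + f_22] on the Fourier side.  The frequency
    [0] follows by continuity.  Riemann sums are compared with antiderivatives,
    and the error is controlled by an integrable majorant coming from the decay
    of the potentials. *)

Require Import Defs.
From mathcomp Require Import all_boot all_order all_algebra.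
From mathcomp Require Import all_classical all_reals all_analysis.
From mathcomp Require Import measurable_realfun.
From mathcomp Require Import ring lra zify.
Import Order.TTheory GRing.Theory Num.Theory.
Import numFieldNormedType.Exports.
Set Implicit Arguments.
Unset Strict Implicit.
Unset Printing Implicit Defensive.
Local Open Scope classical_set_scope.
Local Open Scope ring_scope.

(** * Unconditional sums as limits along an exhausting sequence of finite lists *)

Section exhausting_sums.
Context {R : realType} {I : choiceType}.
Variable s : nat -> seq I.
Hypothesis s_uniq : forall n, uniq (s n).
Hypothesis s_sub : forall m n, (m <= n)%N -> {subset s m <= s n}.
Hypothesis s_cover : forall i, exists n, i \in s n.

Lemma exhausting_sub (F : seq I) : exists n, {subset F <= s n}.
Proof.
elim: F => [|i F [n Fn]]; first by exists 0%N.
have [m im] := s_cover i.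
exists (maxn m n) => j; rewrite inE => /orP[/eqP->|/Fn jn].
  by apply: (s_sub _ im); exact: leq_maxl.
by apply: (s_sub _ jn); exact: leq_maxr.
Qed.

Lemma le_sum_sub (v : I -> R) (t u : seq I) : (forall i, 0 <= v i) ->
  uniq t -> {subset t <= u} -> \sum_(i <- t) v i <= \sum_(i <- u) v i.
Proof.
move=> v0; elim: t u => [|i t IH] u /=.
  by move=> _ _; rewrite big_nil sumr_ge0.
move=> /andP[it ut] tu; rewrite big_cons.
have iu : i \in u by apply: tu; rewrite inE eqxx.
rewrite (perm_big _ (perm_to_rem iu)) /= big_cons lerD2l.
apply: IH => // j jt.
have : j \in u by apply: tu; rewrite inE jt orbT.
rewrite (perm_mem (perm_to_rem iu)) inE => /orP[/eqP ji|//].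
by rewrite -ji jt in it.
Qed.

(** Every finite set of indices lies in some [s n], so the supremum over finite sets that defines
    [esum] is already the supremum of a nondecreasing sequence. *)
Lemma cvg_esum_exhausting (v : I -> R) : (forall i, 0 <= v i) ->
  (\sum_(i <- s n) v i)%:E @[n --> \oo] --> (\esum_(i in setT) (v i)%:E)%E.
Proof.
move=> v0.
have mono : {homo (fun n => (\sum_(i <- s n) v i)%:E) :
    m n / (m <= n)%N >-> (m <= n)%E}.
  by move=> m n mn; rewrite lee_fin; apply: le_sum_sub => //; exact: s_sub.
have fsE (t : seq I) : uniq t ->
    (\sum_(i \in [set` t]) (v i)%:E)%E = (\sum_(i <- t) v i)%:E.
  by move=> ut; rewrite -sumEFin -fsbig_seq.
suff -> : (\esum_(i in setT) (v i)%:E)%E =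
    ereal_sup (range (fun n => (\sum_(i <- s n) v i)%:E)).
  by apply: ereal_nondecreasing_cvgn => m n; exact: mono.
apply/eqP; rewrite eq_le; apply/andP; split.
  apply: ge_ereal_sup => _ [X [finX _] <-].
  have [t Xt] := (finite_seqP X).1 finX.
  have XE : X = [set` undup t].
    by rewrite Xt; apply/seteqP; split=> i /=; rewrite mem_undup.
  have [n tn] := exhausting_sub (undup t).
  apply: (@le_trans _ _ (\sum_(i <- s n) v i)%:E).
    rewrite XE fsE ?undup_uniq// lee_fin.
    by apply: le_sum_sub => //; exact: undup_uniq.
  by apply: ereal_sup_ubound; exists n.
apply: ge_ereal_sup => _ [n _ <-].
apply: ereal_sup_ubound; exists [set` s n]; last by rewrite fsE.
by split.
Qed.

(** The uniform bound [B] makes the sums of the positive and of the negative parts finite, so [fine]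
    and the subtraction in [sum_over] commute with the limit. *)
Lemma cvg_sum_over (P : pred I) (u : I -> R) (B : R) :
  (forall n, \sum_(i <- s n | P i) `|u i| <= B) ->
  \sum_(i <- s n | P i) u i @[n --> \oo] --> sum_over [set i | P i] u.
Proof.
move=> uB.
(* Extending by zero outside [P] lets both parts be summed over the full lists [s n]. *)
pose part (g : R -> R) i := if P i then g (u i) else 0.
have part_ge0 g : (forall x, 0 <= g x) -> forall i, 0 <= part g i.
  by move=> g0 i; rewrite /part; case: ifP.
have cvg_part g : (forall x, 0 <= g x) -> (forall x, g x <= `|x|) ->
    (\esum_(i in [set i | P i]) (g (u i))%:E)%E \is a fin_num /\
    \sum_(i <- s n) part g i @[n --> \oo] -->
      fine (\esum_(i in [set i | P i]) (g (u i))%:E)%E.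
  move=> g0 gle; have := cvg_esum_exhausting (part_ge0 g g0).
  have -> : (\esum_(i in setT) (part g i)%:E)%E =
      (\esum_(i in [set i | P i]) (g (u i))%:E)%E.
    rewrite [RHS]esum_mkcond; apply: eq_esum => i _.
    rewrite /part; case: ifPn => Pi; first by rewrite ifT// inE.
    by rewrite ifF//; apply/negbTE; rewrite notin_setE; exact/negP.
  set S := esum _ _ => cS.
  have finS : S \is a fin_num.
    rewrite ge0_fin_numE; last by apply: esum_ge0 => i _; rewrite lee_fin.
    apply: (@le_lt_trans _ _ B%:E); last exact: ltry.
    rewrite -(cvg_lim _ cS)//; apply: lime_le.
      by apply/cvg_ex; exists S.
    near=> n; rewrite lee_fin (le_trans _ (uB n))// [leRHS]big_mkcond.
    by apply: ler_sum => i _; rewrite /part; case: ifP.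
  split => //; move: cS; rewrite -{1}(fineK finS).
  exact: fine_cvg.
have [posfin cpos] := cvg_part (fun x => Num.max x 0)
  (fun x => ltac:(by rewrite le_max lexx orbT))
  (fun x => ltac:(by rewrite ge_max normr_ge0 ler_norm)).
have [negfin cneg] := cvg_part (fun x => Num.max (- x) 0)
  (fun x => ltac:(by rewrite le_max lexx orbT))
  (fun x => ltac:(by rewrite ge_max normr_ge0 -normrN ler_norm)).
have -> : (fun n => \sum_(i <- s n | P i) u i) =
    (fun n => \sum_(i <- s n) part (fun x => Num.max x 0) i
              - \sum_(i <- s n) part (fun x => Num.max (- x) 0) i).
  apply/funext => n; rewrite -sumrB [LHS]big_mkcond; apply: eq_bigr => i _.
  rewrite /part; case: ifP => _ /=; last by rewrite subrr.
  have [u0|/ltW u0] := leP 0 (u i).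
    by rewrite max_r ?oppr_le0// subr0.
  by rewrite max_l ?oppr_ge0// sub0r opprK.
have -> : sum_over [set i | P i] u =
    fine (\esum_(i in [set i | P i]) (Num.max (u i) 0)%:E)%E -
    fine (\esum_(i in [set i | P i]) (Num.max (- u i) 0)%:E)%E.
  rewrite -fineB// /sum_over; congr (fine (_ - _)%E).
    by apply: eq_esum => i _; rewrite funeposE /= EFin_max.
  by apply: eq_esum => i _; rewrite funenegE /= EFin_max.
exact: cvgB.
Unshelve. all: by end_near. Qed.

End exhausting_sums.

(** * Weighted Riemann sums compared with antiderivatives *)

Section quadrature.
Context {R : realType}.

Lemma nonincreasing_of_derive (G g : R -> R) (a b : R) : a <= b ->
  (forall x : R, is_derive x 1 G (g x)) ->
  (forall x, a <= x <= b -> g x <= 0) -> G b <= G a.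
Proof.
move=> ab dG g0.
apply: (@ler0_derive1_le_cc R G a b) => //.
- move=> x; rewrite in_itv /= => /andP[ax xb].
  by rewrite derive1E derive_val g0// (ltW ax) ltW.
- have /continuous_subspaceT : continuous G => // x.
  by apply/differentiable_continuous/derivable1_diffP; have [] := dG x.
- by rewrite in_itv /= lexx ab.
- by rewrite in_itv /= lexx ab.
Qed.

Variables f w h F W H : R -> R.
Hypothesis w_ge0 : forall x, 0 <= w x.
Hypothesis derF : forall x : R, is_derive x 1 F (f x * w x).
Hypothesis derW : forall x : R, is_derive x 1 W (w x).
Hypothesis derH : forall x : R, is_derive x 1 H (h x * w x).

(* [c * W - F] moves at most as fast as [eps * H], because
   [`|c * w - f * w| <= eps * (h * w)]. *)
Lemma cell_quadrature (eps a b c : R) : a <= b ->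
  (forall y, a <= y <= b -> `|c - f y| <= eps * h y) ->
  `|c * (W b - W a) - (F b - F a)| <= eps * (H b - H a).
Proof.
move=> ab cf.
have side (sg : R) : `|sg| <= 1 ->
    sg * (c * (W b - W a) - (F b - F a)) <= eps * (H b - H a).
  move=> sg1.
  have dG (x : R) : is_derive x 1
      (fun x => sg * (c * W x - F x) - eps * H x)
      (sg * (c * w x - f x * w x) - eps * (h x * w x)).
    have dF := derF x; have dW := derW x; have dH := derH x.
    by apply: is_derive_eq; rewrite /GRing.scale /=; ring.
  have := nonincreasing_of_derive ab dG => /(_ _)/wrap[x axb|le0].
    rewrite subr_le0; apply: (@le_trans _ _ (`|c - f x| * w x)).
      rewrite -mulrBl mulrA ler_wpM2r//.
      apply: le_trans (ler_norm _) _; rewrite normrM.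
      by rewrite ler_piMl.
    by rewrite mulrA ler_wpM2r// cf.
  by lra.
rewrite ler_norml; apply/andP; split.
  by have := side (-1); rewrite mulN1r normrN normr1 lexx lerNl; exact.
by have := side 1; rewrite mul1r normr1 lexx; exact.
Qed.

(** The one-cell estimates telescope. The error involves [H] only at the two ends, so it stays
    bounded however many cells there are once [h * w] is integrable. *)
Lemma sum_quadrature (eps : R) (t p : nat -> R) (m : nat) :
  (forall j, t j <= t j.+1) ->
  (forall j y, (j < m)%N -> t j <= y <= t j.+1 -> `|f (p j) - f y| <= eps * h y) ->
  `|\sum_(j < m) f (p j) * (W (t j.+1) - W (t j)) - (F (t m) - F (t 0%N))|
    <= eps * (H (t m) - H (t 0%N)).
Proof.
move=> tS; elim: m => [|m IH] fp.
  by rewrite big_ord0 !subrr normr0 mulr0.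
have -> : \sum_(j < m.+1) f (p j) * (W (t j.+1) - W (t j)) -
    (F (t m.+1) - F (t 0%N)) =
  (\sum_(j < m) f (p j) * (W (t j.+1) - W (t j)) - (F (t m) - F (t 0%N))) +
  (f (p m) * (W (t m.+1) - W (t m)) - (F (t m.+1) - F (t m))).
  by rewrite big_ord_recr /=; ring.
apply: le_trans (ler_normD _ _) _.
have -> : eps * (H (t m.+1) - H (t 0%N)) =
  eps * (H (t m) - H (t 0%N)) + eps * (H (t m.+1) - H (t m)) by ring.
apply: lerD; first by apply: IH => j y jm; apply: fp; rewrite ltnS ltnW.
by apply: cell_quadrature => // y; apply: fp.
Qed.

End quadrature.

(** * Primitives on the whole line and their increments *)

Section primitive_on_line.
Context {R : realType}.
Notation mu := (@lebesgue_measure R).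
Implicit Types g : R -> R.

Definition primitive g (x : R) : R := \int[mu]_(t in `]-oo, x]) g t.

Lemma is_derive_primitive g (x : R) : continuous g ->
  mu.-integrable [set: R] (EFin \o g) -> is_derive x 1 (primitive g) (g x).
Proof.
move=> cg ig.
have [||||dF F'] := @continuous_FTC1 R g (BInfty R true) x (x + 1).
- by rewrite ltrDl.
- exact: integrableS ig.
- exact: ltNyr.
- by rewrite /prop_for; exact: cg.
by split => //; rewrite -F' derive1E.
Qed.

Lemma primitive_ge0 g (x : R) : (forall y, 0 <= g y) -> 0 <= primitive g x.
Proof. by move=> g0; apply: Rintegral_ge0. Qed.

Lemma primitiveB g (a b : R) : mu.-integrable [set: R] (EFin \o g) -> a <= b ->
  primitive g b - primitive g a = \int[mu]_(t in `]a, b]) g t.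
Proof.
move=> ig ab; rewrite /primitive Rintegral_itvB//.
exact: integrableS ig.
Qed.

Lemma primitive_le g (x : R) : mu.-integrable [set: R] (EFin \o g) ->
  (forall y, 0 <= g y) -> primitive g x <= \int[mu]_t g t.
Proof.
move=> ig g0; apply: fine_le.
- by apply: integrable_fin_num => //; exact: integrableS ig.
- exact: integrable_fin_num.
apply: ge0_subset_integral => //; first exact: (measurable_int mu).
by move=> y _; rewrite lee_fin.
Qed.

Lemma primitive_increment_le g (a b : R) : mu.-integrable [set: R] (EFin \o g) ->
  (forall y, 0 <= g y) -> primitive g b - primitive g a <= \int[mu]_t g t.
Proof.
move=> ig g0; rewrite lerBlDr ler_wpDr ?primitive_ge0//.
exact: primitive_le.
Qed.

(** Dominated convergence for [g] times the indicator of the growing intervals, with majorant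
    [|g|]. *)
Lemma cvg_primitive_increment g (a b : nat -> R) :
  mu.-integrable [set: R] (EFin \o g) -> (forall n, a n <= b n) ->
  a n @[n --> \oo] --> -oo -> b n @[n --> \oo] --> +oo ->
  primitive g (b n) - primitive g (a n) @[n --> \oo] --> \int[mu]_t g t.
Proof.
move=> ig ab ca cb.
have mg := measurable_int mu ig.
pose gn n x := (g x * \1_(`]a n, b n]) x)%:E.
have [|||||_ _ +] := @dominated_convergence _ _ _ mu [set: R] measurableT gn
    (EFin \o g) (fun x => `|(g x)%:E|%E).
- by move=> n; apply/measurable_EFinP; apply: measurable_funM => //;
    exact/measurable_EFinP.
- exact: mg.
- apply: aeW => x _; apply: cvg_near_cst.
  have /cvgrNyPlt/(_ x) ax := ca; have /cvgryPge/(_ x) bx := cb.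
  near=> n; rewrite /gn indicE mem_set ?mulr1//= in_itv/=.
  by apply/andP; split; near: n; [exact: ax|exact: bx].
- exact: integrable_abse.
- apply: aeW => x n _; rewrite /gn abse_EFin lee_fin normrM indicE.
  by rewrite ler_piMr//; case: (_ \in _); rewrite ?normr1 ?normr0.
move=> h.
have fin : (\int[mu]_t (EFin \o g) t)%E \is a fin_num.
  exact: integrable_fin_num.
rewrite -(fineK fin) in h; have {}h := fine_cvg h.
rewrite [X in X @ \oo --> _](_ : _ = fun n => fine (\int[mu]_t gn n t)%E).
  exact: h.
apply/funext => n; rewrite primitiveB// Rintegral_mkcond.
by congr fine; apply: eq_integral => x _ /=; rewrite patch_indic.
Unshelve. all: by end_near. Qed.

Lemma integrable_mul_bounded (f w : R -> R) (B : R) :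
  mu.-integrable [set: R] (EFin \o f) -> continuous w ->
  (forall x, `|w x| <= B) -> mu.-integrable [set: R] (EFin \o (fun x => f x * w x)).
Proof.
move=> intf cw wB.
have mf : measurable_fun [set: R] f by apply/measurable_EFinP; exact: (measurable_int mu).
have mw : measurable_fun [set: R] w by exact: continuous_measurable_fun.
apply: (@le_integrable _ _ _ mu [set: R] measurableT _ (fun x => B%:E * (f x)%:E)%E).
- by apply/measurable_EFinP; exact: measurable_funM.
- move=> x _; rewrite -EFinM !abse_EFin lee_fin !normrM mulrC.
  by rewrite ler_wpM2r// (le_trans (wB x))// ler_norm.
- exact: integrableZl.
Qed.

End primitive_on_line.

(** * A modulus of continuity with an integrable weight *)

Section tempered_modulus.
Context {R : realType}.
Notation mu := (@lebesgue_measure R).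

Lemma le_powR_of_root (th c x : R) : 0 < th -> 0 <= c -> c `^ th^-1 <= x ->
  c <= x `^ th.
Proof.
move=> th0 c0 cx.
rewrite -[leLHS](@powRr1 _ c)// -(mulVf (lt0r_neq0 th0)) powRrM.
apply: ge0_ler_powR => //; rewrite ?nnegrE ?powR_ge0 ?(ltW th0)//.
exact: le_trans (powR_ge0 _ _) cx.
Qed.

(** Using [1 + |y|] in place of [|y|] removes the singularity at the origin, so that one continuous
    positive function serves as majorant on the whole line. *)
Definition power_tail (th y : R) : R := (1 + `|y|) `^ (- (1 + th)).

Lemma addr1_norm_gt0 (y : R) : 0 < 1 + `|y|.
Proof. by rewrite ltr_wpDr. Qed.

Lemma power_tail_gt0 (th y : R) : 0 < power_tail th y.
Proof. by rewrite powR_gt0// addr1_norm_gt0. Qed.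

Lemma continuous_power_tail (th : R) : continuous (power_tail th).
Proof.
move=> y.
have cn : {for y, continuous (fun y : R => 1 + `|y|)}.
  by apply: continuousD; [exact: cst_continuous|exact: norm_continuous].
have cp : {for 1 + `|y|, continuous (@powR R ^~ (- (1 + th)))}.
  apply/differentiable_continuous/derivable1_diffP.
  by have [] := is_derive1_powR (- (1 + th)) (addr1_norm_gt0 y).
exact: (continuous_comp cn cp).
Qed.

Lemma power_tail_antiderivative (th x : R) : 0 < th -> 0 <= x ->
  is_derive x 1 (fun y => - th^-1 * (1 + y) `^ (- th)) (power_tail th x).
Proof.
move=> th0 x0; have x1 : 0 < 1 + x by rewrite ltr_wpDr.
have dp : is_derive (1 + x) 1 (@powR R ^~ (- th)) _ := is_derive1_powR (- th) x1.
have ds : is_derive x (1 : R) (fun y : R => 1 + y) 1.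
  rewrite -[X in is_derive _ _ _ X]add0r.
  exact: (@is_deriveD R R R (cst 1) id x 1 0 1 _ _).
have dc := @is_derive1_comp _ (@powR R ^~ (- th)) (fun y : R => 1 + y) x _ _ dp ds.
have dm : is_derive x (1 : R) (fun y : R => - th^-1 * (1 + y) `^ (- th)) _ :=
  @is_deriveZ _ _ _ _ (- th^-1) _ _ _ dc.
apply: (is_derive_eq dm); rewrite /power_tail ger0_norm// /GRing.scale /= mulr1.
rewrite mulrA mulrNN mulVf ?mul1r ?lt0r_neq0//; congr (_ `^ _); ring.
Qed.

(** By evenness it is enough to integrate over the half-line, where the explicit antiderivative
    tends to [0] at infinity. *)
Lemma integrable_power_tail (th : R) : 0 < th ->
  mu.-integrable [set: R] (EFin \o power_tail th).
Proof.
move=> th0; apply/integrableP; split.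
  by apply/measurable_EFinP; apply: continuous_measurable_fun;
    exact: continuous_power_tail.
have -> : (\int[mu]_x `|(EFin \o power_tail th) x| = \int[mu]_x (power_tail th x)%:E)%E.
  by apply: eq_integral => x _ /=; rewrite ger0_norm// ltW// power_tail_gt0.
rewrite ge0_symfun_integralT.
- rewrite -set_itvcy (@ge0_continuous_FTC2y _ _
    (fun y => - th^-1 * (1 + y) `^ (- th)) 0 0).
  + by rewrite -EFinB -EFinM ltry.
  + by move=> x _; rewrite ltW// power_tail_gt0.
  + exact/continuous_subspaceT/continuous_power_tail.
  + rewrite -[X in _ --> X](mulr0 (- th^-1)); apply: cvgMr.
    apply/cvgrPdist_le => e e0; near=> x.
    have x1 : 0 < 1 + x by rewrite ltr_wpDr//; near: x; exact: nbhs_pinfty_ge.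
    rewrite sub0r normrN ger0_norm ?powR_ge0// powRN.
    rewrite invf_ple ?posrE ?powR_gt0//.
    apply: le_powR_of_root => //; first by rewrite invr_ge0 ltW.
    rewrite -lerBlDl; near: x; exact: nbhs_pinfty_ge.
  + by move=> x /ltW /(power_tail_antiderivative th0) [].
  + have [d0 _] := power_tail_antiderivative th0 (lexx 0).
    by apply: cvg_at_right_filter; move/derivable1_diffP/differentiable_continuous: d0.
  + move=> x; rewrite in_itv/= andbT => /ltW x0.
    by have [_ <-] := power_tail_antiderivative th0 x0; rewrite derive1E.
- by move=> x; rewrite ltW// power_tail_gt0.
- exact: continuous_power_tail.
- by move=> x; rewrite /power_tail /= normrN.
Unshelve. all: by end_near. Qed.

(** Only [y] is confined to the segment; [z] may leave it. Compactness, in its covering form, turns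
    the pointwise radii into a single [d]. *)
Lemma uniform_continuity_segment (f : R -> R) (a b e : R) : continuous f ->
  0 < e -> exists2 d : R, 0 < d & forall z y, a <= y <= b -> `|z - y| <= d ->
    `|f z - f y| <= e.
Proof.
move=> cf e0.
have /compact_near_coveringP := @segment_compact R a b.
move=> /(_ R 0^'+ (fun d y => forall z, `|z - y| <= d -> `|f z - f y| <= e)
  _ _)/wrap[y _|Hd].
  have /cvgrPdist_le/(_ (e / 2)) := cf y.
  rewrite divr_gt0// => /(_ isT) /nbhs_ballP [r /= r0 fr].
  exists (ball y (r / 2), [set d | d < r / 2]) => /=.
    split; first by apply: nbhsx_ballx; rewrite divr_gt0.
    by apply: nbhs_right_lt; rewrite divr_gt0.
  move=> [x d] /= [xy dr] z zx.
  have fx : `|f y - f x| <= e / 2.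
    by apply: fr; apply: le_ball xy; rewrite ler_pdivrMr// ler_peMr ?ltW// ltr1n.
  have fz : `|f y - f z| <= e / 2.
    apply: fr; rewrite /ball /= in xy *.
    have -> : y - z = (y - x) - (z - x) by ring.
    apply: le_lt_trans (ler_normB _ _) _; lra.
  have -> : f z - f x = (f y - f x) - (f y - f z) by ring.
  by apply: le_trans (ler_normB _ _) _; lra.
near (0 : R)^'+ => d; exists d => [//|z y yab].
by apply: (near Hd d); rewrite //= in_itv.
Unshelve. all: by end_near. Qed.

(** On a large segment this is uniform continuity, the tail being bounded below there. Outside,
    [f z] and [f y] are both small: half of the decay exponent [eta] is spent on producing the
    factor [eps], and the other half keeps the majorant integrable. *)
Lemma tempered_modulus (f : R -> R) : continuous f -> strongly_tempered f ->
  exists2 th : R, 0 < th & forall eps : R, 0 < eps ->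
    exists2 d : R, 0 < d & forall z y, `|z - y| <= d ->
      `|f z - f y| <= eps * power_tail th y.
Proof.
move=> cf [r0 [C [eta [r00 C0 eta0 fC]]]].
pose th := eta / 2; have th0 : 0 < th by rewrite divr_gt0.
exists th => // eps eps0.
pose C' := 2 * C * 2 `^ (1 + eta).
have C'0 : 0 < C' by rewrite !mulr_gt0// powR_gt0.
(* If [|y| > A] and [|z - y| <= 1], the summand [3] gives [|z| >= (1 + |y|) / 2], the summand [r0]
   puts [z] in the range of the decay bound, and the last summand gives
   [C' * (1 + |y|) ^ (- th) <= eps]. *)
pose A := 3 + r0 + (C' / eps) `^ th^-1.
have A0 : 0 < A by rewrite ltr_wpDr ?powR_ge0// addr_gt0.
pose m := power_tail th A.
have m0 : 0 < m := power_tail_gt0 th A.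
have [d d0 fd] := @uniform_continuity_segment f (- A) A (eps * m) cf
  (mulr_gt0 eps0 m0).
exists (Num.min d 1) => [|z y]; first by rewrite lt_min d0 ltr01.
rewrite le_min => /andP[zyd zy1].
have X0 := addr1_norm_gt0 y.
have [yA|Ay] := leP `|y| A.
  apply: (le_trans (fd z y _ zyd)); first by rewrite -ler_norml.
  rewrite ler_wpM2l ?(ltW eps0)// /m /power_tail !powRN.
  rewrite lef_pV2 ?posrE ?powR_gt0 ?addr1_norm_gt0//.
  apply: ge0_ler_powR; rewrite ?nnegrE ?(ltW (addr1_norm_gt0 _))//.
    by rewrite addr_ge0// ltW.
  by rewrite lerD2l (gtr0_norm A0).
have Ar0 : 3 + r0 <= A by rewrite lerDl powR_ge0.
have decay x : (1 + `|y|) / 2 <= `|x| -> r0 < `|x| ->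
    `|f x| <= C * 2 `^ (1 + eta) * (1 + `|y|) `^ (- (1 + eta)).
  move=> xy xr; apply: (le_trans (ltW (fC x xr))).
  have -> : C * 2 `^ (1 + eta) * (1 + `|y|) `^ (- (1 + eta)) =
      C * ((1 + `|y|) / 2) `^ (- (1 + eta)).
    rewrite powRM ?(ltW X0)// -[2^-1]powR_inv1// -powRrM mulN1r opprK.
    by rewrite -mulrA [2 `^ _ * _]mulrC.
  rewrite ler_wpM2l ?(ltW C0)// -opprD !powRN.
  have h0 : 0 < (1 + `|y|) / 2 by rewrite divr_gt0.
  rewrite lef_pV2 ?posrE ?powR_gt0 ?(lt_le_trans h0)//.
  by apply: ge0_ler_powR; rewrite ?nnegrE ?normr_ge0 ?(ltW h0)// addr_ge0// ltW.
have zy : `|y| - 1 <= `|z|.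
  have := ler_normB (z - y) z; rewrite (_ : z - y - z = - y) ?normrN; [lra|ring].
apply: (le_trans (ler_normB _ _)).
have fz : `|f z| <= C * 2 `^ (1 + eta) * (1 + `|y|) `^ (- (1 + eta)).
  by apply: decay; lra.
have fy : `|f y| <= C * 2 `^ (1 + eta) * (1 + `|y|) `^ (- (1 + eta)).
  by apply: decay; lra.
apply: (le_trans (lerD fz fy)).
have -> : C * 2 `^ (1 + eta) * (1 + `|y|) `^ (- (1 + eta)) +
    C * 2 `^ (1 + eta) * (1 + `|y|) `^ (- (1 + eta)) =
    C' * (1 + `|y|) `^ (- th) * power_tail th y.
  rewrite /power_tail -[RHS]mulrA -powRD; last by rewrite (gt_eqF X0) implybT.
  rewrite (_ : - th + - (1 + th) = - (1 + eta)); last by rewrite /th; field.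
  by rewrite /C'; ring.
rewrite ler_wpM2r ?(ltW (power_tail_gt0 _ _))// powRN ler_pdivrMr ?powR_gt0//.
rewrite mulrC -ler_pdivrMr//; apply: le_powR_of_root => //.
  by rewrite ltW// divr_gt0.
by rewrite /A in Ay; lra.
Qed.

End tempered_modulus.

(** * Continuity of dilated sines and cosines *)

Section trigonometric_continuity.
Context {R : realType}.

Lemma continuous_cos_mul (b : R) : continuous (fun x : R => cos (b * x)).
Proof.
have cl : continuous (fun x : R => b * x) by move=> x; apply: mulrl_continuous.
move=> x; exact: (@continuous_comp R R R (fun x => b * x) (@cos R) x (cl x)
  (@continuous_cos R _)).
Qed.

Lemma continuous_sin_mul (b : R) : continuous (fun x : R => sin (b * x)).
Proof.
have cl : continuous (fun x : R => b * x) by move=> x; apply: mulrl_continuous.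
move=> x; exact: (@continuous_comp R R R (fun x => b * x) (@sin R) x (cl x)
  (@continuous_sin R _)).
Qed.

End trigonometric_continuity.

(** * Lattices whose density is modulated by a cosine *)

Section modulated_lattice.
Context {R : realType}.
Variables (s ka : R).
Hypothesis s_ge0 : 0 <= s.
Hypothesis s_le : s <= 2^-1.
Hypothesis ka_gt0 : 0 < ka.

(** The offset [c] allows recentring: seen from a particle at [x0], the profile [density 0] becomes
    [density (ka * x0)]. The antiderivative [phase c] counts the mass. *)
Definition density (c x : R) : R := 1 + s * cos (ka * x + c).

Definition phase (c x : R) : R := x + s / ka * sin (ka * x + c).

Lemma density_bounds (c x : R) : 2^-1 <= density c x <= 3 / 2.
Proof.
rewrite /density; have := cos_geN1 (ka * x + c); have := cos_le1 (ka * x + c).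
set y := cos _ => y1 y2; apply/andP; split.
  have sy : - s <= s * y by rewrite -mulrN1 ler_wpM2l.
  have := s_le; lra.
have sy : s * y <= s by rewrite ler_piMr.
have := s_le; lra.
Qed.

Lemma density_ge0 (c x : R) : 0 <= density c x.
Proof. by have /andP[] := density_bounds c x; lra. Qed.

Lemma density_le (c x : R) : density c x <= 3 / 2.
Proof. by have /andP[] := density_bounds c x. Qed.

Lemma is_derive_linear_arg (c x : R) :
  is_derive x 1 (fun x => ka * x + c) ka.
Proof.
have dk := @is_deriveZ _ _ _ id ka x 1 1 (is_derive_id x (1 : R)).
have d := @is_deriveD _ _ _ _ (cst c) x 1 _ _ dk (is_derive_cst c x (1 : R)).
by apply: (is_derive_eq d); rewrite /GRing.scale /= mulr1 addr0.
Qed.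

Lemma continuous_density (c : R) : continuous (density c).
Proof.
move=> x; apply/differentiable_continuous/derivable1_diffP.
have d1 := is_derive_linear_arg c x.
have d2 := @is_derive1_comp _ (@cos R) _ x _ _ (is_derive_cos _) d1.
have d3 := @is_deriveZ _ _ _ _ s _ _ _ d2.
by have [] := @is_deriveD R R R (cst 1) _ _ _ _ _ (is_derive_cst (1 : R) x (1 : R)) d3.
Qed.

Lemma is_derive_phase (c x : R) : is_derive x 1 (phase c) (density c x).
Proof.
have d1 := is_derive_linear_arg c x.
have d2 := @is_derive1_comp _ (@sin R) _ x _ _ (is_derive_sin _) d1.
have d3 := @is_deriveZ _ _ _ _ (s / ka) _ _ _ d2.
have d4 := @is_deriveD R R R id _ _ _ _ _ (is_derive_id x (1 : R)) d3.
apply: (is_derive_eq d4); rewrite /density /GRing.scale /=; field.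
exact: lt0r_neq0.
Qed.

(** The density is at least [1/2]. This yields injectivity of the phase, monotonicity of the lattice
    and the bound on its gaps. *)
Lemma phase_increment (c a b : R) : a <= b ->
  2^-1 * (b - a) <= phase c b - phase c a.
Proof.
move=> ab.
have dG (x : R) : is_derive x (1 : R) (fun x => 2^-1 * x - phase c x)
    (2^-1 - density c x).
  have d := is_derive_phase c x.
  by apply: is_derive_eq; rewrite /GRing.scale /= mulr1.
have := nonincreasing_of_derive ab dG => /(_ _)/wrap[x _|]; last by lra.
by have /andP[] := density_bounds c x; lra.
Qed.

Lemma phase_inj (c : R) : injective (phase c).
Proof.
move=> a b ab; apply/eqP; rewrite eq_le.
wlog ba : a b ab / a <= b.
  by case/orP: (le_total a b) => h /(_ _ _ _ h)H; [|rewrite andbC]; apply: H.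
by rewrite ba /=; have := phase_increment c ba; rewrite ab subrr; lra.
Qed.

Lemma phase_near_id (c x : R) : `|phase c x - x| <= s / ka.
Proof.
rewrite /phase [X in `|X|](_ : _ = s / ka * sin (ka * x + c)); last by ring.
have b0 : 0 <= s / ka by rewrite divr_ge0// ltW.
by rewrite normrM (ger0_norm b0) ler_piMr// ler_norml sin_geN1 sin_le1.
Qed.

(** The phase stays within [b = s / ka] of the identity, so the intermediate value theorem applies
    on [[v - b, v + b]]. *)
Lemma phase_surj (v : R) : exists x, phase 0 x = v.
Proof.
pose b := s / ka.
have b0 : 0 <= b by rewrite divr_ge0// ltW.
have near_id x : `|phase 0 x - x| <= b := phase_near_id 0 x.
have [|||x _ xv] := @IVT R (phase 0) (v - b) (v + b) v.
- lra.
- apply: continuous_subspaceT => x.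
  apply/differentiable_continuous/derivable1_diffP.
  by have [] := is_derive_phase 0 x.
- have := near_id (v - b); have := near_id (v + b); rewrite !ler_norml.
  move=> /andP[h1 h2] /andP[h3 h4]; rewrite ge_min le_max.
  by apply/andP; split; apply/orP; [left|right]; lra.
by exists x.
Qed.

(** Since [phase 0] is bijective for the admissible [s] and [ka], [xget] selects the unique point
    with phase [k * d]; its default [0] is a formality. *)
Definition lattice (d : R) (k : int) : R := xget 0 [set x | phase 0 x = k%:~R * d].

Lemma phase_lattice (d : R) (k : int) : phase 0 (lattice d k) = k%:~R * d.
Proof.
have [x xk] := phase_surj (k%:~R * d).
by rewrite /lattice; case: xgetP => [y -> //|/(_ x) []].
Qed.

Lemma lattice0 (d : R) : lattice d 0 = 0.
Proof.
apply: (@phase_inj 0); rewrite phase_lattice mul0r /phase mulr0 addr0.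
by rewrite sin0 mulr0 addr0.
Qed.

Lemma lattice_lt (d : R) (k l : int) : 0 < d -> k < l -> lattice d k < lattice d l.
Proof.
move=> d0 kl; rewrite ltNge; apply/negP => lk.
have := phase_increment 0 lk; rewrite !phase_lattice -mulrBl.
have : (k%:~R - l%:~R) * d < 0 :> R by rewrite pmulr_llt0// subr_lt0 ltr_int.
by lra.
Qed.

Lemma lattice_gap (d : R) (k l : int) : 0 < d -> k <= l ->
  lattice d l - lattice d k <= 2 * ((l - k)%:~R * d).
Proof.
move=> d0; rewrite le_eqVlt => /predU1P[->|kl].
  by rewrite !subrr mul0r mulr0.
have := phase_increment 0 (ltW (lattice_lt d0 kl)).
by rewrite !phase_lattice intrB mulrBl; lra.
Qed.

(** A translation by [N * d], a full period of the sine, raises the phase by exactly [N * d];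
    injectivity of the phase concludes. *)
Lemma lattice_period (d : R) (N : nat) (k : int) : N%:R * d = 2 * pi / ka ->
  lattice d (k + N%:Z) = lattice d k + N%:R * d.
Proof.
move=> Nd; apply: (@phase_inj 0).
rewrite phase_lattice intrD mulrDl /phase !addr0 mulrDr Nd.
rewrite (_ : ka * (2 * pi / ka) = pi *+ 2); last by field; exact: lt0r_neq0.
rewrite sinD2pi -[k%:~R * d]phase_lattice /phase addr0 -Nd.
by ring.
Qed.

End modulated_lattice.

(** At [s = 0] the phase is the identity, so the equidistant configuration belongs to the same
    family. *)
Lemma lattice_unmodulated {R : realType} (ka d : R) (k : int) : 0 < ka ->
  lattice 0 ka d k = k%:~R * d.
Proof.
move=> ka0; have := @phase_lattice R 0 ka (lexx 0) ka0 d k.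
by rewrite /phase !mul0r addr0.
Qed.

(** * Riemann sums of a potential over a modulated lattice *)

Section modulated_sums.
Context {R : realType}.
Notation mu := (@lebesgue_measure R).

(** For a primitive [G] of [g], the function [G x - G (- x)] has zero derivative and vanishes at
    [0]; its values are the integrals over symmetric windows. *)
Lemma odd_integral0 (g : R -> R) : continuous g ->
  mu.-integrable [set: R] (EFin \o g) -> (forall x, g (- x) = - g x) ->
  \int[mu]_x g x = 0.
Proof.
move=> cg ig godd.
have dG (x : R) : is_derive x (1 : R) (fun x => primitive g x - primitive g (- x)) 0.
  have d1 := is_derive_primitive x cg ig.
  have d2 := is_derive_primitive (- x) cg ig.
  have dN := @is_deriveN _ _ _ id x (1 : R) 1 (is_derive_id x (1 : R)).
  have d3 := @is_derive1_comp _ (primitive g) (fun x : R => - x) x _ _ d2 dN.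
  have d4 := @is_deriveB _ _ _ _ _ _ _ _ _ d1 d3.
  by apply: (is_derive_eq d4); rewrite godd mulrN1 opprK subrr.
have G0 (x : R) : primitive g x - primitive g (- x) = 0.
  by rewrite (is_derive_0_is_cst x 0 dG) oppr0 subrr.
have cN : (fun n => n%:R : R) n @[n --> \oo] --> +oo := cvgr_idn.
have := @cvg_primitive_increment R g (fun n => - n%:R) (fun n => n%:R) ig.
move=> /(_ _ _ cN)/wrap[n||cv].
- by rewrite ge0_cp// ler0n.
- exact/cvgNrNy.
- have <- := cvg_lim (@Rhausdorff R) cv.
  by under eq_fun do rewrite G0; rewrite lim_cst.
Qed.

(** Expand [cos (ka * x + c)]: the sine term is odd because [f] is even, and integrates to zero. *)
Lemma integral_density (f : R -> R) (s ka c : R) : continuous f ->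
  mu.-integrable [set: R] (EFin \o f) -> mirror_symmetric f ->
  \int[mu]_x (f x * density s ka c x) =
    \int[mu]_x f x + s * cos c * \int[mu]_x (f x * cos (ka * x)).
Proof.
move=> cf intf evf.
have ccos := @continuous_cos_mul R ka; have csin := @continuous_sin_mul R ka.
have icos := @integrable_mul_bounded R f _ 1 intf ccos (fun x => cos_max _).
have isin := @integrable_mul_bounded R f _ 1 intf csin (fun x => sin_max _).
have sin0 : \int[mu]_x (f x * sin (ka * x)) = 0.
  apply: odd_integral0 => // [x|x]; last by rewrite evf mulrN sinN mulrN.
  by apply: continuousM; [exact: cf|exact: csin].
have i1 : mu.-integrable [set: R] (EFin \o (fun x => s * cos c * (f x * cos (ka * x)))).
  exact: (integrableZl measurableT (s * cos c) icos).
have i2 : mu.-integrable [set: R] (EFin \o (fun x => s * sin c * (f x * sin (ka * x)))).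
  exact: (integrableZl measurableT (s * sin c) isin).
have i3 : mu.-integrable [set: R]
    (EFin \o (fun x => f x + s * cos c * (f x * cos (ka * x)))).
  exact: (integrableD measurableT intf i1).
transitivity (\int[mu]_x ((f x + s * cos c * (f x * cos (ka * x)))
                         - s * sin c * (f x * sin (ka * x)))).
  by apply: eq_Rintegral => x _; rewrite /density cosD; ring.
by rewrite RintegralB// RintegralD// !RintegralZl// sin0 mulr0 subr0.
Qed.

(** All cells [[t j, t (j + 1)]] have the same mass [d], so [d] times the sum is a Riemann sum
    against [density]. The mesh [dl] is chosen before [s], [ka], [c] and [d], which makes the
    estimate uniform over all particles taken as origin. The bound [B] supplies absolute
    summability. *)
Lemma modulated_sum (f : R -> R) (eps : R) : continuous f ->
  mu.-integrable [set: R] (EFin \o f) -> strongly_tempered f -> 0 < eps ->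
  exists2 dl : R, 0 < dl & forall (s ka c d : R) (t p : int -> R),
    0 <= s -> s <= 2^-1 -> 0 < ka -> 0 < d ->
    (forall j, t j <= p j <= t (j + 1)) ->
    (forall j, t (j + 1) - t j <= dl) ->
    (forall j, phase s ka c (t (j + 1)) - phase s ka c (t j) = d) ->
    (exists B, forall K : nat, \sum_(i < 2 * K) `|f (p (i%:Z - K%:Z))| <= B) /\
    \forall K \near \oo, `|d * \sum_(i < 2 * K) f (p (i%:Z - K%:Z)) -
      \int[mu]_x (f x * density s ka c x)| <= eps.
Proof.
move=> cf intf tf eps0.
have [th th0 modf] := tempered_modulus cf tf.
pose h := power_tail th.
have inth : mu.-integrable [set: R] (EFin \o h) := integrable_power_tail th0.
have h0 x : 0 <= h x by rewrite ltW// power_tail_gt0.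
have ch : continuous h := @continuous_power_tail R th.
pose Ih := \int[mu]_x h x; have Ih0 : 0 <= Ih by apply: Rintegral_ge0.
(* The integral of [h * w] is at most [3 / 2 * Ih], so the quadrature error is at most [eps / 2];
   the other half pays for truncating the integral. *)
pose e1 := eps / 2 / (1 + 3 / 2 * Ih).
have D0 : 0 < 1 + 3 / 2 * Ih by rewrite ltr_wpDr// mulr_ge0.
have e10 : 0 < e1 by rewrite !divr_gt0.
have [dl dl0 fdl] := modf e1 e10.
exists dl => // s ka c d t p s0 s2 ka0 d0 tp tdl tphase.
pose w := density s ka c.
have w0 x : 0 <= w x := density_ge0 ka s0 s2 c x.
have wle x : w x <= 3 / 2 := density_le ka s0 s2 c x.
have wb x : `|w x| <= 3 / 2 by rewrite ger0_norm.
have cw : continuous w := @continuous_density R s ka c.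
have ihw := integrable_mul_bounded inth cw wb.
have hw0 x : 0 <= h x * w x by rewrite mulr_ge0.
have chw : continuous (fun x => h x * w x).
  by move=> x; apply: continuousM; [exact: ch|exact: cw].
have Hle a b : primitive (fun x => h x * w x) b - primitive (fun x => h x * w x) a
    <= 3 / 2 * Ih.
  apply: (le_trans (primitive_increment_le a b ihw hw0)).
  rewrite -RintegralZl//; apply: le_Rintegral => //.
    exact: (integrableZl measurableT (3 / 2) inth).
  by move=> x _; rewrite mulrC ler_wpM2r.
have tS j : t j <= t (j + 1) by have /andP[a b] := tp j; exact: le_trans b.
have quad (g : R -> R) (K : nat) : continuous g ->
    mu.-integrable [set: R] (EFin \o g) ->
    (forall z y, `|z - y| <= dl -> `|g z - g y| <= e1 * h y) ->
    `|d * (\sum_(i < 2 * K) g (p (i%:Z - K%:Z))) -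
      (primitive (fun x => g x * w x) (t K%:Z) -
       primitive (fun x => g x * w x) (t (- K%:Z)))| <= eps / 2.
  move=> cg intg gdl.
  have igw := integrable_mul_bounded intg cw wb.
  have cgw : continuous (fun x => g x * w x).
    by move=> x; apply: continuousM; [exact: cg|exact: cw].
  have eS (i : nat) : i.+1%:Z - K%:Z = (i%:Z - K%:Z) + 1.
    by rewrite intS -addrA addrC.
  have := @sum_quadrature R g w h _ _ _ w0
    (fun x => is_derive_primitive x cgw igw)
    (is_derive_phase s ka0 c)
    (fun x => is_derive_primitive x chw ihw) e1
    (fun i => t (i%:Z - K%:Z)) (fun i => p (i%:Z - K%:Z)) (2 * K).
  move=> /(_ _ _)/wrap[i|i y _|].
  - by rewrite eS.
  - rewrite eS => /andP[ty yt]; apply: gdl.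
    have /andP[tpj pt] := tp (i%:Z - K%:Z); have := tdl (i%:Z - K%:Z).
    by rewrite ler_norml; lra.
  under eq_bigr do rewrite eS tphase.
  rewrite -mulr_suml mulrC.
  rewrite (_ : (2 * K)%:Z - K%:Z = K%:Z); last by rewrite mul2n -addnn PoszD addrK.
  rewrite sub0r.
  move/le_trans; apply; apply: (@le_trans _ _ (e1 * (3 / 2 * Ih))).
    by rewrite ler_wpM2l ?(ltW e10)// Hle.
  rewrite /e1 mulrAC ler_pdivrMr// ler_wpM2l ?divr_ge0 ?(ltW eps0)//.
  by rewrite lerDr.
(* By the reverse triangle inequality [|f|] has the same modulus as [f], so [quad] also bounds the
   sums of absolute values. *)
split.
  have cnf : continuous (fun x => `|f x|).
    by move=> x; apply: (continuous_comp (cf x)); exact: norm_continuous.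
  have infn : mu.-integrable [set: R] (EFin \o (fun x => `|f x|)).
    exact: (integrable_abse intf).
  have infw := integrable_mul_bounded infn cw wb.
  exists ((eps / 2 + \int[mu]_x (`|f x| * w x)) / d) => K.
  rewrite ler_pdivlMr// mulrC.
  have := quad (fun x => `|f x|) K cnf infn
    (fun z y zy => le_trans (ler_dist_dist _ _) (fdl z y zy)).
  have := @primitive_increment_le R (fun x => `|f x| * w x) (t (- K%:Z)) (t K%:Z)
    infw (fun y => mulr_ge0 (normr_ge0 _) (w0 y)).
  rewrite ler_norml => le1 /andP[_ le2]; lra.
have NS (n : nat) : - n.+1%:Z + 1 = - n%:Z by rewrite intS opprD addrAC addNr add0r.
have PS (n : nat) : n%:Z + 1 = n.+1%:Z by rewrite intS addrC.
(* The phase of [t] grows linearly and stays within [s / ka] of the identity, hence [t] tends to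
   infinity in both directions. *)
have phN (n : nat) : phase s ka c (t n%:Z) = phase s ka c (t 0) + n%:R * d.
  elim: n => [|n IH]; first by rewrite mul0r addr0.
  have := tphase n%:Z; rewrite PS IH mulrSr; lra.
have phNN (n : nat) : phase s ka c (t (- n%:Z)) = phase s ka c (t 0) - n%:R * d.
  elim: n => [|n IH]; first by rewrite mul0r subr0.
  have := tphase (- n.+1%:Z); rewrite (NS n).
  rewrite IH mulrSr; lra.
have near_id x := phase_near_id s0 ka0 c x.
have nd : (fun n : nat => n%:R * d) n @[n --> \oo] --> +oo.
  apply/cvgryPge => A; have /cvgryPge/(_ (A / d)) := @cvgr_idn R.
  by apply: filterS => n; rewrite ler_pdivrMr.
have cT : t n%:Z @[n --> \oo] --> +oo.
  apply/cvgryPge => A.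
  have /cvgryPge/(_ (A - phase s ka c (t 0) + s / ka)) := nd.
  apply: filterS => n; have := near_id (t n%:Z); rewrite phN ler_norml; lra.
have cTN : t (- n%:Z) @[n --> \oo] --> -oo.
  apply/cvgrNyPle => A.
  have /cvgryPge/(_ (phase s ka c (t 0) + s / ka - A)) := nd.
  apply: filterS => n; have := near_id (t (- n%:Z)); rewrite phNN ler_norml; lra.
have ifw := integrable_mul_bounded intf cw wb.
have tle (n : nat) : t (- n%:Z) <= t n%:Z.
  elim: n => // n IH; apply: (le_trans _ (le_trans IH _)).
    by have := tS (- n.+1%:Z); rewrite NS.
  by have := tS n%:Z; rewrite PS.
have := @cvg_primitive_increment R _ _ _ ifw tle cTN cT.
move=> /cvgrPdist_le/(_ (eps / 2)); rewrite divr_gt0// => /(_ isT).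
apply: filterS => K; have := quad f K cf intf fdl.
rewrite !ler_norml; lra.
Qed.

End modulated_sums.

(** * Average of the cosine over a parity class *)

Section lattice_averages.
Context {R : realType}.

(** The even lattice points cut one period into [M] cells of mass [2 * d], and the integral of
    [cos (ka * x) * (1 + s * cos (ka * x))] over a period [L] is [s * L / 2]. Leaving [p j] free in
    its cell covers both parity classes. *)
Lemma lattice_cos_average (s ka eps : R) : 0 <= s -> s <= 2^-1 -> 0 < ka ->
  0 < eps -> exists2 dl : R, 0 < dl & forall (M : nat) (d : R) (p : nat -> R),
    0 < d -> 4 * d <= dl -> (2 * M)%:R * d = 2 * pi / ka ->
    (forall j, lattice s ka d (2 * j)%:Z <= p j <= lattice s ka d (2 * j.+1)%:Z) ->
    `|2 * d * (\sum_(j < M) cos (ka * p j)) - s / 2 * (2 * pi / ka)| <= eps.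
Proof.
move=> s0 s2 ka0 eps0; pose L := 2 * pi / ka.
have L0 : 0 < L by rewrite divr_gt0// mulr_gt0// pi_gt0.
pose f x : R := cos (ka * x).
have cf : continuous f := @continuous_cos_mul R ka.
have [dl dl0 fdl] := @uniform_continuity_segment R f 0 L (eps / L) cf (divr_gt0 eps0 L0).
exists dl => // M d p d0 ddl Md tp.
(* Antiderivative of [f * density] obtained from the double-angle formula. *)
pose F x : R := sin (ka * x) / ka + s * (x / 2 + sin (2 * ka * x) / (4 * ka)).
have dF (x : R) : is_derive x (1 : R) F (f x * density s ka 0 x).
  have ds (b : R) : is_derive x (1 : R) (fun x => sin (b * x)) (cos (b * x) * b).
    have dk : is_derive x (1 : R) (fun x => b * x) b.
      have := @is_deriveZ _ _ _ id b x 1 1 (is_derive_id x (1 : R)).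
      by rewrite /GRing.scale /= mulr1.
    exact: (@is_derive1_comp _ (@sin R) (fun x => b * x) x _ _ (is_derive_sin _) dk).
  have d1 := ds ka; have d2 := ds (2 * ka).
  apply: is_derive_eq; rewrite /f /density addr0 /GRing.scale /=.
  rewrite (_ : 2 * ka * x = ka * x + ka * x); last by ring.
  rewrite cosD -!expr2 sin2cos2; field; exact: lt0r_neq0.
have dH (x : R) : is_derive x (1 : R) (phase s ka 0) (1 * density s ka 0 x).
  by rewrite mul1r; exact: is_derive_phase.
pose t (j : nat) := lattice s ka d (2 * j)%:Z.
have tmono (i j : nat) : (i <= j)%N -> t i <= t j.
  move=> ij; case: (ltngtP i j) ij => // [ij _|-> //].
  by rewrite ltW// lattice_lt// ltz_nat ltn_pmul2l.
have t0 : t 0%N = 0 by exact: lattice0.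
have tM : t M = L.
  rewrite /t -[(2 * M)%:Z]add0r lattice_period// lattice0// add0r.
  exact: Md.
(* The majorant is the constant [1], whose weighted antiderivative is the phase; it grows by [L]
   over the period and turns [eps / L] into [eps]. *)
have := @sum_quadrature R f (density s ka 0) (fun=> 1) F (phase s ka 0) (phase s ka 0)
  (density_ge0 ka s0 s2 0) dF (is_derive_phase s ka0 0) dH (eps / L) t p M.
move=> /(_ _ _)/wrap[j|j y jM tjy|].
- exact: tmono.
- rewrite mulr1; apply: fdl.
    move: tjy => /andP[ty yt]; rewrite -t0 -tM (le_trans _ ty) ?tmono//=.
    by rewrite (le_trans yt) ?tmono.
  have /andP[h1 h2] := tp j; move: tjy => /andP[h3 h4].
  have gap : t j.+1 - t j <= 4 * d.
    have kl : ((2 * j)%:Z <= (2 * j.+1)%:Z)%R.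
      by rewrite lez_nat leq_mul2l leqnSn orbT.
    have := lattice_gap s0 s2 ka0 d0 kl.
    rewrite (_ : (2 * j.+1)%:Z - (2 * j)%:Z = 2%:Z); last first.
      by rewrite mulnS PoszD addrK.
    by rewrite /t; lra.
  by rewrite ler_norml; move: h1 h2 h3 h4 gap; rewrite /t; lra.
have tph j : phase s ka 0 (t j) = (2 * j)%:R * d by rewrite phase_lattice.
under eq_bigr do rewrite !tph.
rewrite (_ : \sum_(j < M) f (p j) * ((2 * j.+1)%:R * d - (2 * j)%:R * d) =
    2 * d * \sum_(j < M) cos (ka * p j)); last first.
  rewrite mulr_sumr; apply: eq_bigr => j _.
  by rewrite /f mulnS natrD; ring.
rewrite !tph muln0 mul0r subr0 t0 tM Md -/L.
rewrite (_ : F L - F 0 = s / 2 * L); last first.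
  rewrite /F !mulr0 sin0 !mul0r.
  rewrite (_ : ka * L = pi *+ 2); last by rewrite /L; field; exact: lt0r_neq0.
  rewrite (_ : 2 * ka * L = pi *+ 2 + pi *+ 2); last first.
    by rewrite /L; field; exact: lt0r_neq0.
  rewrite sinD2pi -[pi *+ 2]add0r sinD2pi sin0; ring.
by rewrite mulfVK// lt0r_neq0.
Qed.

End lattice_averages.

(** * Symmetric windows of indices, split by parity *)

Section windows.

(** The offset [2 * K] is even, so the window breaks into consecutive pairs whose first index has
    the parity of [n]. *)
Definition window (n : int) (K : nat) : seq int :=
  [seq n + (i%:Z - (2 * K)%:Z) | i <- iota 0 (2 * (2 * K))].

Lemma mem_window (n k : int) (K : nat) :
  (k \in window n K) = (n - (2 * K)%:Z <= k < n + (2 * K)%:Z).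
Proof.
apply/mapP/idP => [[i + ->]|kn]; first by rewrite mem_iota; lia.
by exists (absz (k - n + (2 * K)%:Z)); [rewrite mem_iota; lia|lia].
Qed.

Lemma window_uniq (n : int) (K : nat) : uniq (window n K).
Proof. by rewrite map_inj_uniq ?iota_uniq// => i j; lia. Qed.

Lemma window_sub (n : int) (K K' : nat) : (K <= K')%N ->
  {subset window n K <= window n K'}.
Proof. by move=> KK' k; rewrite !mem_window; lia. Qed.

Lemma window_cover (n k : int) : exists K, k \in window n K.
Proof. by exists (absz (k - n)).+1; rewrite mem_window; lia. Qed.

Lemma sum_nat_pairs {R : realType} (g : nat -> R) (m : nat) :
  \sum_(i < 2 * m) g i = \sum_(j < m) (g (2 * j)%N + g (2 * j).+1).
Proof.
elim: m => [|m IH]; first by rewrite !big_ord0.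
by rewrite mulnS !big_ord_recr /= IH addrA.
Qed.

Lemma sum_window {R : realType} (n : int) (u : int -> R) (K : nat) :
  \sum_(k <- window n K) u k =
    \sum_(j < 2 * K) (u (n + 2 * (j%:Z - K%:Z)) + u (n + 2 * (j%:Z - K%:Z) + 1)).
Proof.
rewrite big_map -{1}[(2 * (2 * K))%N]subn0 -/(index_iota _ _) big_mkord.
rewrite (sum_nat_pairs (fun i => u (n + (i%:Z - (2 * K)%:Z)))).
by apply: eq_bigr => j _; congr (u _ + u _); lia.
Qed.

Definition other (a : species) := if a is type1 then type2 else type1.

Lemma species_of_even (n j : int) : species_of (n + 2 * j) = species_of n.
Proof. by rewrite /species_of; congr (if _ then _ else _); lia. Qed.

Lemma species_of_odd (n j : int) :
  species_of (n + 2 * j + 1) = other (species_of n).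
Proof. by rewrite /species_of; case: ifPn; case: ifPn => //; lia. Qed.

Lemma species_of_double (j : nat) : species_of (2 * j)%:Z = type2.
Proof. by rewrite /species_of ifT//; lia. Qed.

Lemma species_of_double_succ (j : nat) : species_of (2 * j).+1%:Z = type1.
Proof. by rewrite /species_of ifF//; apply/negbTE; lia. Qed.

End windows.

(** * Limit of the energy of one particle *)

Section site_energy.
Context {R : realType}.
Notation mu := (@lebesgue_measure R).
Variable phi : species -> species -> R -> R.
Hypothesis phi_cont : forall a b, continuous (phi a b).
Hypothesis phi_int : forall a b, mu.-integrable [set: R] (EFin \o phi a b).
Hypothesis phi_temp : forall a b, strongly_tempered (phi a b).
Hypothesis phi_sym : forall a b, mirror_symmetric (phi a b).

Definition site_energy (x : int -> R) (n : int) : R :=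
  sum_over [set k | k != n]
    (fun k => phi (species_of n) (species_of k) (x k - x n)).

Definition cos_integral (ka : R) (a b : species) : R :=
  \int[mu]_x (phi a b x * cos (ka * x)).

Definition site_limit (s ka c : R) (a : species) : R :=
  \int[mu]_x phi a type1 x + \int[mu]_x phi a type2 x +
  s * cos c * (cos_integral ka a type1 + cos_integral ka a type2).

Lemma site_limitE (s ka c : R) (a : species) :
  site_limit s ka c a = \int[mu]_x (phi a a x * density s ka c x) +
    \int[mu]_x (phi a (other a) x * density s ka c x).
Proof. by rewrite !integral_density// /site_limit /cos_integral; case: a => /=; ring. Qed.

(** There are only four pairs of species, so the least of their four meshes serves all of them. *)
Lemma modulated_sum_uniform (eps : R) : 0 < eps -> exists2 dl : R, 0 < dl &
  forall (a b : species) (s ka c d : R) (t p : int -> R),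
    0 <= s -> s <= 2^-1 -> 0 < ka -> 0 < d ->
    (forall j, t j <= p j <= t (j + 1)) ->
    (forall j, t (j + 1) - t j <= dl) ->
    (forall j, phase s ka c (t (j + 1)) - phase s ka c (t j) = d) ->
    (exists B, forall K : nat, \sum_(i < 2 * K) `|phi a b (p (i%:Z - K%:Z))| <= B) /\
    \forall K \near \oo, `|d * \sum_(i < 2 * K) phi a b (p (i%:Z - K%:Z)) -
      \int[mu]_x (phi a b x * density s ka c x)| <= eps.
Proof.
move=> eps0.
have ms a b := modulated_sum (@phi_cont a b) (phi_int a b) (phi_temp a b) eps0.
have [d11 d11_gt0 h11] := ms type1 type1; have [d12 d12_gt0 h12] := ms type1 type2.
have [d21 d21_gt0 h21] := ms type2 type1; have [d22 d22_gt0 h22] := ms type2 type2.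
exists (Num.min (Num.min d11 d12) (Num.min d21 d22)).
  by rewrite !lt_min d11_gt0 d12_gt0 d21_gt0 d22_gt0.
move=> a b s ka c d t p s0 s2 ka0 d0 tp tdl tph.
have {}tdl j : [/\ t (j + 1) - t j <= d11, t (j + 1) - t j <= d12,
    t (j + 1) - t j <= d21 & t (j + 1) - t j <= d22].
  by have := tdl j; rewrite !le_min => /andP[/andP[? ?] /andP[? ?]].
by case: a; case: b; [apply: h11|apply: h12|apply: h21|apply: h22] => // j;
  have [] := tdl j.
Qed.

(** Restoring the self-interaction completes the Riemann sum over the particles of the same type.
    Each type contributes one [eps], and [2 * d] is the mass between consecutive particles of one
    type. *)
Lemma site_energy_limit (eps : R) : 0 < eps -> exists2 dl : R, 0 < dl &
  forall (s ka d : R) (n : int), 0 <= s -> s <= 2^-1 -> 0 < ka -> 0 < d ->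
    4 * d <= dl ->
    `|2 * d * (site_energy (lattice s ka d) n + phi (species_of n) (species_of n) 0)
      - site_limit s ka (ka * lattice s ka d n) (species_of n)| <= 2 * eps.
Proof.
move=> eps0; have [dl dl0 ms] := modulated_sum_uniform eps0.
exists dl => // s ka d n s0 s2 ka0 d0 ddl; set a := species_of n; set x := lattice s ka d.
have d20 : 0 < 2 * d by rewrite mulr_gt0.
(* Both sums use the cells between consecutive particles of the type of [n]: the same type is
   sampled at the left ends [t], the other type at the intermediate points [q]. *)
pose t j := x (n + 2 * j) - x n.
pose q j := x (n + 2 * j + 1) - x n.
have xle (k l : int) : k <= l -> x k <= x l.
  by rewrite le_eqVlt => /predU1P[->//|kl]; rewrite ltW// lattice_lt.
have nS (j : int) : n + 2 * (j + 1) = n + 2 * j + 1 + 1 by ring.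
have tq j : t j <= q j <= t (j + 1).
  by rewrite /t /q nS !lerD2r !xle// lerDl.
have tt j : t j <= t j <= t (j + 1).
  by rewrite lexx; have /andP[h1 h2] := tq j; exact: le_trans h2.
have gap j : t (j + 1) - t j <= dl.
  have kl : n + 2 * j <= n + 2 * (j + 1) by rewrite nS -addrA lerDl.
  have := lattice_gap s0 s2 ka0 d0 kl.
  rewrite (_ : n + 2 * (j + 1) - (n + 2 * j) = 2%:Z); last by ring.
  rewrite /t /x (_ : 2%:Z%:~R = 2 :> R)//; lra.
have phase_t j : phase s ka (ka * x n) (t j) = (n + 2 * j)%:~R * d - x n.
  rewrite -(phase_lattice s0 ka0 d) -/x /phase /t addr0.
  rewrite (_ : ka * (x (n + 2 * j) - x n) + ka * x n = ka * x (n + 2 * j)); last by ring.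
  by ring.
have tph j : phase s ka (ka * x n) (t (j + 1)) - phase s ka (ka * x n) (t j) = 2 * d.
  by rewrite !phase_t !intrD !intrM intrD; ring.
have [[B1 b1] lim1] := ms a a s ka (ka * x n) (2 * d) t t s0 s2 ka0 d20 tt gap tph.
have [[B2 b2] lim2] :=
  ms a (other a) s ka (ka * x n) (2 * d) t q s0 s2 ka0 d20 tq gap tph.
pose u k := phi a (species_of k) (x k - x n).
have u_even j : u (n + 2 * j) = phi a a (t j) by rewrite /u species_of_even.
have u_odd j : u (n + 2 * j + 1) = phi a (other a) (q j).
  by rewrite /u species_of_odd.
have sumK (g : R -> R) K : \sum_(k <- window n K) g (u k) =
    \sum_(i < 2 * K) g (phi a a (t (i%:Z - K%:Z))) +
    \sum_(i < 2 * K) g (phi a (other a) (q (i%:Z - K%:Z))).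
  by rewrite sum_window -big_split; apply: eq_bigr => i _; rewrite /= u_even u_odd.
have cv := @cvg_sum_over R int (window n) (window_uniq n) (@window_sub n)
  (window_cover n) (fun k => k != n) u (B1 + B2).
have {}cv := cv (fun K => le_trans _ (lerD (b1 K) (b2 K))).
have {}cv : \sum_(k <- window n K | k != n) u k @[K --> \oo] --> site_energy x n.
  apply: cv => K; rewrite -(sumK Num.norm) [leLHS]big_mkcond /=.
  by apply: ler_sum => k _; case: ifP.
(* The estimate holds for all large finite windows and passes to the limit by continuity of the
   norm. *)
pose G K := `|2 * d * (\sum_(k <- window n K | k != n) u k + phi a a 0) -
  site_limit s ka (ka * x n) a|.
have cG : G K @[K --> \oo] -->
    `|2 * d * (site_energy x n + phi a a 0) - site_limit s ka (ka * x n) a|.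
  apply: cvg_norm; apply: cvgB; last exact: cvg_cst.
  by apply: cvgMr; apply: cvgD => //; exact: cvg_cst.
rewrite -(cvg_lim (@Rhausdorff R) cG); apply: limr_le.
  by apply/cvg_ex; eexists; exact: cG.
near=> K; rewrite /G.
(* The window with [K = 0] is empty, hence the requirement [0 < K]. *)
have nK : n \in window n K.
  have K0 : (0 < K)%N by near: K; exact: nbhs_infty_gt.
  by rewrite mem_window; move: K0; clear; lia.
have un : u n = phi a a 0 by rewrite /u subrr.
have -> : \sum_(k <- window n K | k != n) u k + phi a a 0 = \sum_(k <- window n K) u k.
  by rewrite [RHS](bigD1_seq n) ?window_uniq//= un addrC.
rewrite (sumK id) site_limitE.
have h1 : `|2 * d * \sum_(i < 2 * K) phi a a (t (i%:Z - K%:Z)) -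
    \int[mu]_x0 (phi a a x0 * density s ka (ka * x n) x0)| <= eps.
  by near: K.
have h2 : `|2 * d * \sum_(i < 2 * K) phi a (other a) (q (i%:Z - K%:Z)) -
    \int[mu]_x0 (phi a (other a) x0 * density s ka (ka * x n) x0)| <= eps.
  by near: K.
rewrite mulrDr opprD addrACA; apply: (le_trans (ler_normD _ _)).
by rewrite [leRHS]mulr_natl mulr2n lerD.
Unshelve. all: by end_near. Qed.

End site_energy.

(** * Energy comparison at a positive frequency *)

Section fourier_positivity.
Context {R : realType}.
Notation mu := (@lebesgue_measure R).

Lemma cos_integral_ge0 (phi : species -> species -> R -> R) (ka : R) :
  (forall a b, continuous (phi a b)) ->
  (forall a b, mu.-integrable [set: R] (EFin \o phi a b)) ->
  (forall a b, strongly_tempered (phi a b)) ->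
  (forall a b, mirror_symmetric (phi a b)) ->
  0 < ka ->
  (exists rho0 : R, forall (N : nat) (rho : R) (y : int -> R),
     (0 < N)%N -> ~~ odd N -> 0 < rho -> rho0 < rho -> periodic_config rho N y ->
     \sum_(1 <= n < N.+1) site_energy phi (equidistant rho) n%:Z <=
     \sum_(1 <= n < N.+1) site_energy phi y n%:Z) ->
  0 <= (cos_integral phi ka type1 type1 + cos_integral phi ka type1 type2) +
       (cos_integral phi ka type2 type1 + cos_integral phi ka type2 type2).
Proof.
move=> cphi iphi tphi sphi ka0 [rho0 min0].
pose J a := cos_integral phi ka a type1 + cos_integral phi ka a type2.
rewrite -/(J type1) -/(J type2).
apply/ler_addgt0Pr => e e0.
pose L := 2 * pi / ka.
have L0 : 0 < L by rewrite divr_gt0// mulr_gt0// pi_gt0.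
(* The errors will add up to [(|J type1| + |J type2| + 16 * L) * eps = 2 * D * eps]; the choice of
   [eps] makes this [e * L / 4], to match the factor [L / 4] of the main term. *)
pose D := (`|J type1| + `|J type2|) / 2 + 8 * L.
have D0 : 0 < D.
  by apply: ltr_wpDl; [rewrite divr_ge0// addr_ge0|rewrite mulr_gt0].
pose eps := e * L / (8 * D).
have eps0 : 0 < eps by apply: divr_gt0; exact: mulr_gt0.
have half0 : 0 <= 2^-1 :> R by rewrite invr_ge0.
have [dl1 dl10 site] := site_energy_limit cphi iphi tphi sphi eps0.
have [dl2 dl20 avg] := lattice_cos_average half0 (lexx _) ka0 eps0.
pose dl := Num.min dl1 dl2.
have dl0 : 0 < dl by rewrite lt_min dl10 dl20.
(* The first summand forces [4 * d = 2 * L / M] below [dl]; the second forces the density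
   [2 * M / L] above [rho0]. *)
pose M := (Num.bound (2 * L / dl + `|L * rho0|)).+1.
have MP : 2 * L / dl + `|L * rho0| <= M%:R.
  apply/ltW/(@lt_trans _ _ (Num.bound (2 * L / dl + `|L * rho0|))%:R);
    last by rewrite ltr_nat.
  apply: archi_boundP.
  by rewrite addr_ge0// divr_ge0 ?(ltW dl0)// mulr_ge0// ltW.
have M0 : 0 < M%:R :> R by rewrite ltr0n.
pose d := L / (2 * M)%:R.
have N0 : 0 < (2 * M)%:R :> R by rewrite natrM mulr_gt0.
have d0 : 0 < d by rewrite divr_gt0.
have Nd : (2 * M)%:R * d = L by rewrite /d mulrC divfK// lt0r_neq0.
have Md : M%:R * d = L / 2 by rewrite -Nd natrM; field.
have d4 : 4 * d <= dl.
  have : 2 * L / dl <= M%:R by have := normr_ge0 (L * rho0); lra.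
  rewrite ler_pdivrMr// => h.
  by rewrite -(ler_pM2l M0) mulrCA Md; lra.
have [d41 d42] : 4 * d <= dl1 /\ 4 * d <= dl2.
  by move: d4; rewrite le_min => /andP[].
have rhoE : d^-1 = (2 * M)%:R / L by rewrite /d invf_div.
have rho_gt : rho0 < d^-1.
  rewrite rhoE ltr_pdivlMr// mulrC natrM.
  have := ler_norm (L * rho0).
  have : 0 <= 2 * L / dl by rewrite divr_ge0 ?(ltW dl0)// mulr_ge0// ltW.
  by move: MP M0; lra.
pose x := lattice 2^-1 ka d.
have xper : periodic_config d^-1 (2 * M) x.
  split; first exact: lattice0.
  - by move=> k; apply: lattice_lt => //; rewrite ltrDl.
  - by move=> k; rewrite invrK mulrC; apply: lattice_period.
have le0 : equidistant d^-1 = lattice 0 ka d.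
  by apply/funext => k; rewrite /equidistant invrK lattice_unmodulated.
have := min0 (2 * M)%N d^-1 x; rewrite le0 -subr_ge0 -sumrB.
move=> /(_ isT _ _ rho_gt xper)/wrap[||].
- by rewrite oddM.
- by rewrite invr_gt0.
(* Between [s = 1/2] and [s = 0] the self-interaction and the plain integrals cancel; each of the
   two limits costs [2 * eps]. *)
have diff (n : int) : 2 * d * (site_energy phi x n - site_energy phi (lattice 0 ka d) n)
    <= 2^-1 * (cos (ka * x n) * J (species_of n)) + 4 * eps.
  have := site 2^-1 ka d n half0 (lexx _) ka0 d0 d41.
  have := site 0 ka d n (lexx _) half0 ka0 d0 d41.
  rewrite -/x /site_limit -/(J _) mul0r mul0r addr0 !ler_norml.
  move: (site_energy phi x n) (site_energy phi (lattice 0 ka d) n) => S S0.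
  move: (phi _ _ 0) (\int[mu]_y phi _ type1 y) (\int[mu]_y phi _ type2 y) => Q I1 I2.
  move: (cos _) (J _) (eps) (d) => c j eps' d'.
  move=> /andP[h1 h2] /andP[h3 h4].
  suff -> : 2^-1 * (c * j) = 2^-1 * c * j by lra.
  by ring.
move=> sum0.

(* The sum starts at [1], so the odd indices are [2 * j + 1] and the even ones [2 * j + 2]; both lie
   in the cell between the lattice points [2 * j] and [2 * j + 2]. *)
have pairs (g : int -> R) : \sum_(1 <= n < (2 * M).+1) g n%:Z =
    \sum_(j < M) g (2 * j).+1%:Z + \sum_(j < M) g (2 * j.+1)%:Z.
  rewrite big_add1 big_mkord (sum_nat_pairs (fun i => g i.+1%:Z)) big_split /=.
  by congr (_ + _); apply: eq_bigr => j _; rewrite mulnS.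
have xmono (i j : nat) : (i <= j)%N -> x i%:Z <= x j%:Z.
  rewrite leq_eqVlt => /predU1P[->//|ij].
  by apply/ltW/lattice_lt.
have avg1 : `|2 * d * \sum_(j < M) cos (ka * x (2 * j).+1%:Z) - 2^-1 / 2 * L| <= eps.
  apply: (avg M d (fun j => x (2 * j).+1%:Z) d0 d42 Nd) => j.
  by apply/andP; split; apply: xmono; clear; lia.
have avg2 : `|2 * d * \sum_(j < M) cos (ka * x (2 * j.+1)%:Z) - 2^-1 / 2 * L| <= eps.
  apply: (avg M d (fun j => x (2 * j.+1)%:Z) d0 d42 Nd) => j.
  by apply/andP; split; apply: xmono; clear; lia.
have spec1 (j : nat) : species_of (2 * j).+1%:Z = type1.
  exact: species_of_double_succ.
have spec2 (j : nat) : species_of (2 * j.+1)%:Z = type2.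
  exact: species_of_double.
have {sum0} : 0 <= \sum_(1 <= n < (2 * M).+1)
    (2^-1 * (cos (ka * x n%:Z) * J (species_of n%:Z)) + 4 * eps).
  have d20 : 0 <= 2 * d by rewrite mulr_ge0// ltW.
  apply: (le_trans (mulr_ge0 d20 sum0)).
  by rewrite mulr_sumr; apply: ler_sum => n _; exact: diff.
rewrite (pairs (fun n => 2^-1 * (cos (ka * x n) * J (species_of n)) + 4 * eps)).
under eq_bigr do rewrite spec1.
under [X in _ + X]eq_bigr do rewrite spec2.
rewrite !big_split /= !sumr_const card_ord -!mulr_sumr -!mulr_suml.
rewrite -[4 * eps *+ M]mulr_natl.
move: avg1 avg2.
set C1 := \sum_(j < M) cos (ka * x (2 * j).+1%:Z).
set C2 := \sum_(j < M) cos (ka * x (2 * j.+1)%:Z).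
move=> avg1 avg2 le.
have bound (a : species) (C : R) : `|2 * d * C - 2^-1 / 2 * L| <= eps ->
    2 * d * (C * J a) <= L / 4 * J a + `|J a| * eps.
  move=> dC.
  have : J a * (2 * d * C - 2^-1 / 2 * L) <= `|J a| * eps.
    by apply: (le_trans (ler_norm _)); rewrite normrM ler_wpM2l.
  move: (`|J a| * eps) => v.
  suff -> : J a * (2 * d * C - 2^-1 / 2 * L) =
    2 * d * (C * J a) - L / 4 * J a by lra.
  by field.
have b1 := bound type1 C1 avg1; have b2 := bound type2 C2 avg2.
(* Multiplication by [4 * d] normalizes both cosine sums to their averages; as [M * d = L / 2], the
   site errors become [16 * L * eps]. *)
have main : 0 <= L / 4 * J type1 + `|J type1| * eps +
    (L / 4 * J type2 + `|J type2| * eps) + 16 * (L * eps).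
  have d40 : 0 <= 4 * d by rewrite mulr_ge0// ltW.
  have := mulr_ge0 d40 le.
  suff -> : 4 * d * (2^-1 * (C1 * J type1) + M%:R * (4 * eps) +
      (2^-1 * (C2 * J type2) + M%:R * (4 * eps))) =
      2 * d * (C1 * J type1) + 2 * d * (C2 * J type2) + 16 * (L * eps) by lra.
  rewrite (_ : L = 2 * (M%:R * d)); last by rewrite Md; field.
  by field.
have epsE : (`|J type1| + `|J type2| + 16 * L) * eps = e * L / 4.
  rewrite /eps (_ : `|J type1| + `|J type2| + 16 * L = 2 * D).
    by field; exact: lt0r_neq0.
  by rewrite /D; field.
have : 0 <= L / 4 * (J type1 + J type2 + e).
  by move: main epsE; lra.
by rewrite pmulr_rge0// divr_gt0.
Qed.

End fourier_positivity.

(** * Continuity of the cosine integral at frequency zero *)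

Section vanishing_frequency.
Context {R : realType}.
Notation mu := (@lebesgue_measure R).

(** Dominated convergence with majorant [|f|]; one sequence of positive frequencies tending to [0]
    is enough to transfer a sign. *)
Lemma cvg_cos_integral0 (f : R -> R) : mu.-integrable [set: R] (EFin \o f) ->
  \int[mu]_x (f x * cos (n.+1%:R^-1 * x)) @[n --> \oo] -->
  \int[mu]_x (f x * cos (0 * x)).
Proof.
move=> intf.
have icos b := integrable_mul_bounded intf (@continuous_cos_mul R b)
  (fun x => cos_max (b * x)).
have [|||||_ _ h] := @dominated_convergence _ _ _ mu [set: R] measurableT
    (fun n x => (f x * cos (n.+1%:R^-1 * x))%:E) (fun x => (f x * cos (0 * x))%:E)
    (fun x => `|(f x)%:E|%E).
- by move=> n; exact: (measurable_int mu (icos _)).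
- exact: (measurable_int mu (icos 0)).
- apply: aeW => x _; apply: cvg_EFin; first exact: nearW.
  apply: cvgMr; apply: (@cvg_comp _ _ _ (fun n => n.+1%:R^-1 * x) (@cos R)).
    by apply: cvgMl; exact: cvg_harmonic.
  exact: continuous_cos.
- exact: integrable_abse.
- apply: aeW => x n _; rewrite !abse_EFin lee_fin normrM.
  by rewrite ler_piMr// cos_max.
have fin : (\int[mu]_x (f x * cos (0 * x))%:E)%E \is a fin_num.
  exact: (integrable_fin_num measurableT (icos 0)).
rewrite -(fineK fin) in h; exact: (fine_cvg h).
Qed.

Lemma C2_continuous (f : R -> R) : class_C2 f -> continuous f.
Proof.
by move=> [df _ _] x; apply/differentiable_continuous/derivable1_diffP.
Qed.

End vanishing_frequency.

(** * From cosine integrals to the Fourier transform at every real frequency *)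

Theorem proposition2p9 (R : realType) (f11 f22 f12 : R -> R)
  (f11_C2 : class_C2 f11) (f22_C2 : class_C2 f22) (f12_C2 : class_C2 f12)
  (f11_L1 : class_L1 f11) (f22_L1 : class_L1 f22) (f12_L1 : class_L1 f12)
  (f11_sym : mirror_symmetric f11) (f22_sym : mirror_symmetric f22)
  (f12_sym : mirror_symmetric f12)
  (f11_temp : strongly_tempered f11) (f22_temp : strongly_tempered f22)
  (f12_temp : strongly_tempered f12)
  (equidistant_min : exists rho0 : R, forall (N : nat) (rho : R),
     (0 < N)%N -> ~~ odd N -> 0 < rho -> rho0 < rho ->
     is_minimizer (energy f11 f22 f12 N) (periodic_config rho N)
       (equidistant rho)) :
  forall k : R,
    0 <= fourier f12 k + 2^-1 * (fourier f11 k + fourier f22 k).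
Proof.
pose phi := interaction f11 f22 f12.
pose I (f : R -> R) k := \int[@lebesgue_measure R]_x (f x * cos (k * x)).
have pos k : 0 < k -> 0 <= I f11 k + I f12 k + (I f12 k + I f22 k).
  move=> k0; apply: (@cos_integral_ge0 R phi) => //.
  - have cont f : class_C2 f -> continuous f := @C2_continuous R f.
    by case; case;
      [exact: (cont f11)|exact: (cont f12)|exact: (cont f12)|exact: (cont f22)].
  - by case; case.
  - by case; case.
  - by case; case.
  have [rho0 min0] := equidistant_min.
  exists rho0 => N rho y N0 Nodd rho_gt0 rho_gt yper.
  have [_ /(_ y yper)] := min0 N rho N0 Nodd rho_gt0 rho_gt.
  (* The positive prefactor cancels, and the rest of [energy] is by definition the sum of the site
     energies. *)
  by rewrite /energy ler_pM2l// invr_gt0 ltr0n.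
have nonneg k : 0 <= I f11 k + I f12 k + (I f12 k + I f22 k).
  (* Negative frequencies reduce to positive ones by evenness of the cosine, and frequency [0] is a
     limit along [1 / (n + 1)]. *)
  have [k_lt0|k_gt0|->] := ltgtP k 0; [|exact: pos|].
    have IN f : I f k = I f (- k).
      by apply: eq_Rintegral => x _; rewrite mulNr cosN.
    by rewrite !IN pos// oppr_gt0.
  have c11 := cvg_cos_integral0 f11_L1; have c22 := cvg_cos_integral0 f22_L1.
  have c12 := cvg_cos_integral0 f12_L1.
  have c : (fun n => let k := n.+1%:R^-1 : R in
      I f11 k + I f12 k + (I f12 k + I f22 k)) @ \oo -->
      I f11 0 + I f12 0 + (I f12 0 + I f22 0).
    by apply: cvgD; apply: cvgD.
  rewrite -[leRHS](cvg_lim (@Rhausdorff R) c); apply: limr_ge.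
    by apply/cvg_ex; eexists; exact: c.
  by apply: nearW => n; apply: pos; rewrite invr_gt0 ltr0n.
move=> k; rewrite /fourier -/(I f11 k) -/(I f12 k) -/(I f22 k).
have := nonneg k; set r := _^-1 => Ik.
have r0 : 0 <= r by rewrite invr_ge0 sqrtr_ge0.
(* The claim is half of [r] times the nonnegative combination, in which [f12] already occurs
   twice. *)
have := mulr_ge0 r0 Ik; lra.
Qed.
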